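(* Under the setting and assumptions (M), (A1)–(A4) described in the context, fix a query feature $s\in S$ and a query datacube $h_q\in\mathcal H$. Suppose $\liminf_{NT\to\infty} E[\hat f(s,h_q)]>0$. Then the kernel estimator is consistent: $\hat g(s,h_q)\to g(s,h_q)$ in probability as $NT\to\infty$.
   Context: Setting. For each $N$ (number of nodes) and $T$ (number of timesteps) one observes random directed graphs $G_1,\dots,G_T$ on the vertex set $\{1,\dots,N\}$; $p\ge 1$ is a fixed lag, constant with respect to $N,T$. The local neighborhood $N_t(i)$ of node $i$ in $G_t$ is the set of nodes within 2 hops of $i$ together with all edges among them. Each node pair $(i,j)$ at time $t$ carries a pair-feature $g_t(i,j)$ taking values in a fixed finite set $S$. For $s\in S$, let $n_{i,t}(s)$ be the number of node pairs in $N_t(i)$ with pair-feature $s$ at time $t$, and $n^+_{i,t}(s)$ the number of those pairs that are joined by an edge at time $t+1$. The datacube of $i$ at time $t$ is $h_{i,t}=\{(n_{i,t-1}(s),n^+_{i,t-1}(s)):s\in S\}$; it summarizes the evolution of the neighborhood of $i$ from $t-1$ to $t$. Model (M): there is an unknown function $g:S\times\mathcal H\to[0,1]$ such that for all $i,t,s$: $E[n^+_{i,t+1}(s)\mid h_{i,t},\,n_{i,t+1}(s)] = n_{i,t+1}(s)\,g(s,h_{i,t})$. (This follows from the model that each edge indicator $Y_{t+1}(i,j)$ is, given the graph history, Bernoulli with parameter $g(g_t(i,j),h_{i,t})$.) Kernel: $K_b(h,h')=b^{D(h,h')}$ with bandwidth $0<b<1$, where $D\ge 0$ is the distance $D(h,h')=\sum_{s\in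 S}\mathrm{TV}\big(\mathcal N(\hat p_s,\hat p_s(1-\hat p_s)/n(s)),\mathcal N(\hat p'_s,\hat p'_s(1-\hat p'_s)/n'(s))\big)$, $\hat p_s=n^+(s)/n(s)$, TV the total variation distance; it is assumed that $D(h,h')=0$ iff $h=h'$, so that $\lim_{b\to 0}K_b(h,h')=1$ if $h=h'$ and $0$ otherwise. Estimator for query feature $s$ and query datacube $h_q$: $\hat h(s,h_q)=\frac{1}{N(T-p-2)}\sum_{t=p}^{T-2}\sum_{i=1}^N K_b(h_{i,t},h_q)\,n^+_{i,t+1}(s)$, $\hat f(s,h_q)=\frac{1}{N(T-p-2)}\sum_{t=p}^{T-2}\sum_{i=1}^N K_b(h_{i,t},h_q)\,n_{i,t+1}(s)$, and $\hat g(s,h_q)=\hat h(s,h_q)/\hat f(s,h_q)$ (defined when $\hat f>0$). (A1) Finite dimensionality: there is a constant $M$ independent of $N,T$ bounding all neighborhood sizes; hence all datacubes $h_{i,t}$ and counts $n_{i,t}(s),n^+_{i,t}(s)$ take values in a fixed finite set ($\mathcal H$ denotes the finite set of possible datacubes), independent of $N,T$. (A2) Bandwidth convergence: $b=b_{N,T}\to 0$ as $NT\to\infty$. Stacked graph and distance: form the graph obtained by stacking $G_1,\dots,G_T$ and joining each node $i$ at time $t$ to node $i$ at times $t-1$ and $t+1$. For index pairs $(i,t),(i',t')$, let $\mathrm{dist}((i,t),(i',t'))$ be the length of the shortest path in the stacked graph between any node of the datacube of $(i,t)$ and any node of the datacube of $(i',t')$ (it is $0$ when they share nodes). (A3) Strong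 mixing: with $\mathcal F(i,t)$ the sigma-algebra generated by the random variables in the datacube of $(i,t)$ (including the associated counts $n_{i,t+1},n^+_{i,t+1}$), let $\alpha(k)=\sup\{|P(A\cap B)-P(A)P(B)|: A\in\mathcal F(i,t),B\in\mathcal F(i',t'),\ \mathrm{dist}((i,t),(i',t'))\ge k\}$, with $\alpha$ not depending on $N,T$; assume $\sum_{k=1}^\infty \alpha(k)k^{\rho-1}<\infty$, where $\rho$ is the intrinsic dimensionality of the graphs, a constant independent of $N,T$. (A4) Growth (a consequence of bounded intrinsic dimensionality $\rho$, 2-hop neighborhoods and constant lag $p$): there is a constant $C$ independent of $N,T$ such that for every $(i,t)$ the number of index pairs $(i',t')$ with $\mathrm{dist}((i,t),(i',t'))=0$ is at most $C$, and the number with $\mathrm{dist}((i,t),(i',t'))=d$ is at most $C d^{\rho-1}$ for every $d\ge 1$. *)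

(* Defs.v *)
From HB Require Import structures.
From mathcomp Require Import all_boot all_order all_algebra.
From mathcomp Require Import all_classical all_reals all_analysis.
Set Implicit Arguments. Unset Strict Implicit. Unset Printing Implicit Defensive.
Import Order.TTheory GRing.Theory Num.Theory.
Import numFieldNormedType.Exports.
Local Open Scope classical_set_scope.
Local Open Scope ring_scope.

(* A datacube: for each pair-feature s, the pair (n(s), n^+(s)). *)
Definition datacube (S : finType) := {ffun S -> nat * nat}.

Definition in_range (p T t : nat) : bool := (p <= t <= T - 2)%N.

(* "Eventually as NT -> oo" over the admissible pairs (N,T) (T >= p+3, so
   that the normalization N(T-p-2) is positive). *)
Definition eventuallyNT (p : nat) (Q : nat -> nat -> Prop) : Prop :=
  exists K : nat, forall N T : nat, (p + 3 <= T)%N -> (K <= N * T)%N -> Q N T.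

Section Model.
Variables (R : realType) (S : finType) (dd : measure_display) (Om : measurableType dd).
Variables (N : nat) (n nplus : 'I_N -> nat -> S -> Om -> nat).

Definition dcube (i : 'I_N) (t : nat) (w : Om) : datacube S :=
  [ffun s' => (n i t.-1 s' w, nplus i t.-1 s' w)].

(* The random variables "in the datacube of (i,t)", including the associated
   counts n_{i,t+1}, n^+_{i,t+1}; F(i,t) contains the sigma-algebra they
   generate. *)
Definition obs (i : 'I_N) (t : nat) (w : Om) : datacube S * datacube S :=
  (dcube i t w, [ffun s' => (n i t.+1 s' w, nplus i t.+1 s' w)]).

Definition kern (D : datacube S -> datacube S -> R) (b : R) (h h' : datacube S) : R :=
  b `^ (D h h').

Variables (p T : nat) (D : datacube S -> datacube S -> R) (b : R)
  (s : S) (hq : datacube S).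

Definition hhat (w : Om) : R :=
  (N * (T - p - 2))%:R^-1 *
  \sum_(p <= t < (T - 2).+1) \sum_(i < N) kern D b (dcube i t w) hq * (nplus i t.+1 s w)%:R.

Definition fhat (w : Om) : R :=
  (N * (T - p - 2))%:R^-1 *
  \sum_(p <= t < (T - 2).+1) \sum_(i < N) kern D b (dcube i t w) hq * (n i t.+1 s w)%:R.

Definition ghat (w : Om) : R := hhat w / fhat w.

End Model.

(* Main.v *)
(* By (M), the residual [hhat - g(s,hq) fhat] would have mean zero if the
   kernel were the indicator of [hq]; since b -> 0 and only finitely many
   datacubes occur, its mean tends to 0.  Both [fhat] and the residual are
   averages of bounded functions of the finitely-valued observations, so strong
   mixing bounds the covariance of two summands by a constant times
   alpha(dist), and the growth condition makes the sum of these over the second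
   index bounded.  Hence both variances are O(1/(N(T-p-2))), and Chebyshev's
   inequality yields fhat >= c/2 and a small residual with high probability. *)
Require Import Defs.
From HB Require Import structures.
From mathcomp Require Import all_boot all_order all_algebra.
From mathcomp Require Import all_classical all_reals all_analysis.
From mathcomp Require Import measurable_realfun ring lra zify.
Set Implicit Arguments. Unset Strict Implicit. Unset Printing Implicit Defensive.
Import Order.TTheory GRing.Theory Num.Theory.
Import numFieldNormedType.Exports.
Local Open Scope classical_set_scope.
Local Open Scope ring_scope.

(** * Real-valued calculus of expectations for bounded random variables *)

Section BoundedRandomVariables.
Context (R : realType) (dd : measure_display) (Om : measurableType dd).
Variable P : probability Om R.
Implicit Types (X Y : Om -> R) (A : set Om).

Local Notation "''Ex' X" := (fine ('E_P[X%R])%E) (at level 10, X at level 8).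

(** Under a probability measure boundedness gives integrability and, unlike integrability, is stable
    under products. Every expectation below is thus finite, and [fine] turns it into a real number
    that obeys linear algebra. *)
Definition bounded_rv X :=
  measurable_fun setT X /\ exists B : R, forall w, `|X w| <= B.

Lemma bounded_rv_Lfun X : bounded_rv X -> X \in Lfun P 1.
Proof.
case=> mX [B hB]; apply/Lfun1_integrable/measurable_bounded_integrable => //.
  by rewrite -ge0_fin_numE// fin_num_measure.
exists B; split; first exact: num_real.
by move=> x Bx w _ /=; exact: le_trans (hB w) (ltW Bx).
Qed.

Lemma bounded_rv_cst c : bounded_rv (fun=> c).
Proof. by split; [exact: measurable_cst | exists `|c|]. Qed.

Lemma bounded_rvD X Y : bounded_rv X -> bounded_rv Y ->
  bounded_rv (fun w => X w + Y w).
Proof.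
move=> [mX [B hB]] [mY [C hC]]; split; first exact: measurable_funD.
by exists (B + C) => w; rewrite (le_trans (ler_normD _ _)) ?lerD.
Qed.

Lemma bounded_rvM X Y : bounded_rv X -> bounded_rv Y ->
  bounded_rv (fun w => X w * Y w).
Proof.
move=> [mX [B hB]] [mY [C hC]]; split; first exact: measurable_funM.
by exists (B * C) => w; rewrite normrM ler_pM.
Qed.

Lemma bounded_rvZ c X : bounded_rv X -> bounded_rv (fun w => c * X w).
Proof. exact: bounded_rvM (bounded_rv_cst c). Qed.

Lemma bounded_rvB X Y : bounded_rv X -> bounded_rv Y ->
  bounded_rv (fun w => X w - Y w).
Proof.
move=> bX bY; have := bounded_rvD bX (bounded_rvZ (-1) bY).
by under eq_fun do rewrite mulN1r.
Qed.

Lemma bounded_rv_sum (I : Type) (r : seq I) (Q : pred I) (F : I -> Om -> R) :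
  (forall i, Q i -> bounded_rv (F i)) ->
  bounded_rv (fun w => \sum_(i <- r | Q i) F i w).
Proof.
move=> bF; elim: r => [|i r IH].
  have -> : (fun w => \sum_(i <- [::] | Q i) F i w) = fun=> 0.
    by apply/funext => w; rewrite big_nil.
  exact: bounded_rv_cst.
have -> : (fun w => \sum_(j <- i :: r | Q j) F j w) =
    if Q i then fun w => F i w + \sum_(j <- r | Q j) F j w
    else fun w => \sum_(j <- r | Q j) F j w.
  by apply/funext => w; rewrite big_cons; case: ifP.
by case: ifPn => // /bF bFi; exact: bounded_rvD.
Qed.

Lemma bounded_rv_indic A : measurable A -> bounded_rv \1_A.
Proof.
move=> mA; split; first exact: measurable_indic.
by exists 1 => w; rewrite indicE; case: (_ \in _); rewrite ?normr1 ?normr0.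
Qed.

Lemma fine_expectationD X Y : bounded_rv X -> bounded_rv Y ->
  'Ex (fun w => X w + Y w) = 'Ex X + 'Ex Y.
Proof.
move=> /bounded_rv_Lfun bX /bounded_rv_Lfun bY.
by rewrite (expectationD bX bY) fineD ?expectation_fin_num.
Qed.

Lemma fine_expectationZ c X : bounded_rv X ->
  'Ex (fun w => c * X w) = c * 'Ex X.
Proof.
move=> /bounded_rv_Lfun bX.
have -> : (fun w => c * X w) = c \o* X by apply/funext => w /=; rewrite mulrC.
by rewrite (expectationZl c bX) fineM ?expectation_fin_num.
Qed.

Lemma fine_expectationB X Y : bounded_rv X -> bounded_rv Y ->
  'Ex (fun w => X w - Y w) = 'Ex X - 'Ex Y.
Proof.
move=> /bounded_rv_Lfun bX /bounded_rv_Lfun bY.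
by rewrite (expectationB bX bY) fineB ?expectation_fin_num.
Qed.

Lemma fine_expectation_cst c : 'Ex (fun=> c) = c.
Proof. by rewrite expectation_cst. Qed.

Lemma fine_expectation_sum (I : Type) (r : seq I) (Q : pred I)
    (F : I -> Om -> R) : (forall i, Q i -> bounded_rv (F i)) ->
  'Ex (fun w => \sum_(i <- r | Q i) F i w) = \sum_(i <- r | Q i) 'Ex (F i).
Proof.
move=> bF; elim: r => [|i r IH].
  have -> : (fun w => \sum_(i <- [::] | Q i) F i w) = fun=> 0.
    by apply/funext => w; rewrite big_nil.
  by rewrite big_nil fine_expectation_cst.
have -> : (fun w => \sum_(j <- i :: r | Q j) F j w) =
    if Q i then fun w => F i w + \sum_(j <- r | Q j) F j w
    else fun w => \sum_(j <- r | Q j) F j w.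
  by apply/funext => w; rewrite big_cons; case: ifP.
rewrite big_cons.
by case: ifPn => // Qi; rewrite fine_expectationD ?IH//; [exact: bF|exact: bounded_rv_sum].
Qed.

Lemma fine_expectation_indic A : measurable A -> 'Ex (\1_A) = fine (P A).
Proof. by move=> mA; rewrite expectation_indic. Qed.

Lemma fine_expectation_ge0 X : (forall w, 0 <= X w) -> 0 <= 'Ex X.
Proof. by move=> X0; rewrite fine_ge0// expectation_ge0. Qed.

Lemma fine_expectation_le X Y : bounded_rv X -> bounded_rv Y ->
  (forall w, X w <= Y w) -> 'Ex X <= 'Ex Y.
Proof.
move=> bX bY XY; rewrite -subr_ge0 -fine_expectationB//.
by apply: fine_expectation_ge0 => w; rewrite subr_ge0.
Qed.

Lemma measurable_abs_sub_ge X e : bounded_rv X ->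
  measurable [set w | e <= `|X w - 'Ex X|].
Proof.
move=> bX; have [mY _] := bounded_rvB bX (bounded_rv_cst ('Ex X)).
rewrite -[X in measurable X]setTI.
pose Y w := `|X w - 'Ex X|.
have mnY : measurable_fun setT Y by exact: measurableT_comp.
have := measurable_fun_ler (measurable_cst e) mnY.
move=> /(_ measurableT [set true]); apply => //.
Qed.

(** Pointwise, the indicator of the deviation event is at most [e ^- 2] times the squared deviation;
    integrate. *)
Lemma bounded_chebyshev X e : bounded_rv X -> 0 < e ->
  fine (P [set w | e <= `|X w - 'Ex X|]) <=
    e ^- 2 * 'Ex (fun w => (X w - 'Ex X) * (X w - 'Ex X)).
Proof.
move=> bX e0; have bY := bounded_rvB bX (bounded_rv_cst ('Ex X)).
have mA := measurable_abs_sub_ge e bX.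
rewrite -fine_expectation_indic// -fine_expectationZ; last exact: bounded_rvM.
apply: fine_expectation_le => [||w]; first exact: bounded_rv_indic.
  exact/bounded_rvZ/bounded_rvM.
rewrite indicE; have [|] := boolP (w \in _); last first.
  by rewrite -expr2 mulr_ge0 ?sqr_ge0// invr_ge0 exprn_ge0// ltW.
rewrite inE /= => h; rewrite mulrC ler_pdivlMr ?exprn_gt0// mul1r -expr2.
by rewrite -[leRHS]real_normK ?num_real// lerXn2r// nnegrE ltW.
Qed.

Lemma fine_variance_sum (I : finType) (Q : pred I) (F : I -> Om -> R) :
  (forall i, Q i -> bounded_rv (F i)) ->
  let S := fun w => \sum_(i | Q i) F i w in
  'Ex (fun w => (S w - 'Ex S) * (S w - 'Ex S)) =
  \sum_(i | Q i) \sum_(j | Q j)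
     ('Ex (fun w => F i w * F j w) - 'Ex (F i) * 'Ex (F j)).
Proof.
move=> bF S.
pose G i w := F i w - 'Ex (F i).
have bG i : Q i -> bounded_rv (G i).
  by move=> Qi; apply: bounded_rvB; [exact: bF|exact: bounded_rv_cst].
have SE w : S w - 'Ex S = \sum_(i | Q i) G i w.
  by rewrite /S fine_expectation_sum// -sumrB.
under eq_fun do rewrite SE big_distrlr/=.
have bGG i j : Q i -> Q j -> bounded_rv (fun w => G i w * G j w).
  by move=> Qi Qj; apply: bounded_rvM; exact: bG.
rewrite fine_expectation_sum => [|i Qi]; last first.
  by apply: bounded_rv_sum => j Qj; exact: bGG.
apply: eq_bigr => i Qi; rewrite fine_expectation_sum => [|j Qj]; last exact: bGG.
apply: eq_bigr => j Qj.
(* The second bracket has mean zero, and the first has the covariance as its mean. *)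
have E w : G i w * G j w = (F i w * F j w - 'Ex (F j) * F i w)
    - ('Ex (F i) * F j w - 'Ex (F i) * 'Ex (F j)) by rewrite /G; ring.
under eq_fun do rewrite E.
have [bi bj] := (bF i Qi, bF j Qj).
have bij := bounded_rvM bi bj.
have [bi' bj'] := (bounded_rvZ ('Ex (F j)) bi, bounded_rvZ ('Ex (F i)) bj).
rewrite fine_expectationB; [|exact: bounded_rvB|]; last first.
  by apply: bounded_rvB => //; exact: bounded_rv_cst.
rewrite fine_expectationB// fine_expectationB//; last exact: bounded_rv_cst.
rewrite fine_expectation_cst (fine_expectationZ ('Ex (F j)) bi).
rewrite (fine_expectationZ ('Ex (F i)) bj).
by rewrite subrr subr0 mulrC.
Qed.

(** * Finitely valued variables and the covariance bound from mixing *)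

Section DiscreteVariables.
Variables (T : eqType) (s : seq T).
Hypothesis us : uniq s.

(** The value type carries no sigma-algebra, so measurability is expressed through level sets; with
    finitely many values this makes every function of [V] measurable and bounded. *)
Definition discrete_rv (V : Om -> T) :=
  (forall w, V w \in s) /\ (forall a, measurable (V @^-1` [set a])).

Implicit Types (U V : Om -> T) (phi psi : T -> R).

Lemma discrete_rv_indic V phi : discrete_rv V ->
  (fun w => phi (V w)) =
  (fun w => \sum_(a <- s) phi a * \1_(V @^-1` [set a]) w).
Proof.
move=> [sV _]; apply/funext => w.
rewrite (bigD1_seq (V w))//= indicE mem_set// mulr1 big1 ?addr0// => a aV.
by rewrite indicE memNset ?mulr0//= => Va; rewrite Va eqxx in aV.
Qed.

Lemma discrete_rv_bounded V phi : discrete_rv V ->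
  bounded_rv (fun w => phi (V w)).
Proof.
move=> dV; rewrite discrete_rv_indic//; apply: bounded_rv_sum => a _.
exact/bounded_rvZ/bounded_rv_indic/dV.2.
Qed.

Lemma fine_expectation_discrete V phi : discrete_rv V ->
  'Ex (fun w => phi (V w)) =
  \sum_(a <- s) phi a * fine (P (V @^-1` [set a])).
Proof.
move=> dV; have bI a := bounded_rv_indic (dV.2 a).
rewrite discrete_rv_indic// fine_expectation_sum => [|a _]; last exact: bounded_rvZ.
apply: eq_bigr => a _; rewrite fine_expectationZ// fine_expectation_indic//.
exact: dV.2.
Qed.

Lemma fine_expectation_discreteM U V phi psi : discrete_rv U -> discrete_rv V ->
  'Ex (fun w => phi (U w) * psi (V w)) =
  \sum_(a <- s) \sum_(c <- s) phi a * psi c *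
    fine (P (U @^-1` [set a] `&` V @^-1` [set c])).
Proof.
move=> dU dV.
have mI a c : measurable (U @^-1` [set a] `&` V @^-1` [set c]).
  by apply: measurableI; [exact: dU.2|exact: dV.2].
have bI a c := bounded_rv_indic (mI a c).
have -> : (fun w => phi (U w) * psi (V w)) = (fun w =>
    \sum_(a <- s) \sum_(c <- s) phi a * psi c *
      \1_(U @^-1` [set a] `&` V @^-1` [set c]) w).
  apply/funext => w; have /(congr1 (@^~ w)) /= -> := discrete_rv_indic phi dU.
  have /(congr1 (@^~ w)) /= -> := discrete_rv_indic psi dV.
  rewrite big_distrlr/=; apply: eq_bigr => a _; apply: eq_bigr => c _.
  by rewrite indicI/= mulrACA.
rewrite fine_expectation_sum => [|a _]; last first.
  by apply: bounded_rv_sum => c _; exact: bounded_rvZ.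
apply: eq_bigr => a _; rewrite fine_expectation_sum => [|c _]; last exact: bounded_rvZ.
by apply: eq_bigr => c _; rewrite fine_expectationZ// fine_expectation_indic.
Qed.

(** Expanding over pairs of values [(a, c)], the covariance is a sum of [phi a * psi c] times the
    defect of independence of the events [U = a] and [V = c]. Each defect is at most [al], and there
    are [size s] squared pairs. *)
Lemma mixing_covariance_le U V phi psi (B al : R) :
  discrete_rv U -> discrete_rv V ->
  (forall a, a \in s -> `|phi a| <= B) -> (forall a, a \in s -> `|psi a| <= B) ->
  (forall A C : set T, (`|P (U @^-1` A `&` V @^-1` C) -
      P (U @^-1` A) * P (V @^-1` C)| <= al%:E)%E) ->
  'Ex (fun w => phi (U w) * psi (V w)) -
    'Ex (fun w => phi (U w)) * 'Ex (fun w => psi (V w)) <=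
  (size s)%:R ^+ 2 * B ^+ 2 * al.
Proof.
move=> dU dV hphi hpsi mix.
rewrite fine_expectation_discreteM// !fine_expectation_discrete// big_distrlr/=.
rewrite -sumrB (@le_trans _ _ (\sum_(a <- s) \sum_(c <- s) B ^+ 2 * al))//; last first.
  rewrite !big_const_seq !count_predT !iter_addr_0 -mulrnA -[leLHS]mulr_natl.
  by rewrite natrM expr2 mulrA.
rewrite big_seq [leRHS]big_seq; apply: ler_sum => a sa; rewrite -sumrB.
rewrite big_seq [leRHS]big_seq; apply: ler_sum => c sc.
rewrite mulrACA -mulrBr (le_trans (ler_norm _))// normrM ler_pM//.
  by rewrite normrM expr2 ler_pM ?hphi ?hpsi.
have mUa := dU.2 a; have mVc := dV.2 c.
rewrite -lee_fin -abse_EFin EFinB EFinM !fineK ?fin_num_measure//.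
exact: measurableI.
Qed.

End DiscreteVariables.
End BoundedRandomVariables.

(** * Summing mixing coefficients and concentration of averages *)

(** Group the indices into shells of equal distance [k]. The shell sizes turn the sum into [C] times
    a partial sum of the mixing series, which lies below the limit because its terms are
    nonnegative. *)
Lemma sum_mixing_le (R : realType) (J : finType) (Q : pred J) (dl : J -> nat)
    (al : nat -> R) (C r : R) :
  (forall k, 0 <= al k) ->
  cvgn (series (fun k => al k.+1 * k.+1%:R `^ r) : R^nat) ->
  #|[pred j | Q j && (dl j == 0%N)]|%:R <= C ->
  (forall k, (1 <= k)%N -> #|[pred j | Q j && (dl j == k)]|%:R <= C * k%:R `^ r) ->
  \sum_(j | Q j) al (dl j) <=
  C * (al 0%N + limn (series (fun k => al k.+1 * k.+1%:R `^ r) : R^nat)).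
Proof.
move=> al0 cv C0 Ck; set u := series _ in cv *.
pose m := \max_j dl j.
have hm j : (dl j < m.+1)%N by rewrite ltnS; exact: leq_bigmax.
have u_nd : nondecreasing_seq u.
  by apply/nondecreasing_seqP => k; rewrite /u seriesSr lerDl mulr_ge0 ?powR_ge0.
rewrite (partition_big (fun j => Ordinal (hm j)) xpredT)//=.
have E (k : 'I_m.+1) : \sum_(j | Q j && (Ordinal (hm j) == k)) al (dl j) =
    #|[pred j | Q j && (dl j == k)]|%:R * al k.
  rewrite (eq_bigr (fun=> al k)) => [|j /andP[_ /eqP <-]//].
  by rewrite mulr_natl -(@sumr_const _ _ [pred j | Q j && (dl j == k)]).
under eq_bigr do rewrite E.
(* Shell 0 is split off, since its size bound is [C] itself; the other shells match the shifted
   series index [k.+1]. *)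
rewrite big_ord_recl/= mulrDr lerD//; first exact: ler_wpM2r.
have C_ge0 : 0 <= C by apply: le_trans C0; rewrite ler0n.
apply: le_trans (ler_wpM2l C_ge0 (nondecreasing_cvgn_le u_nd cv m)).
rewrite /u /series/= big_mkord mulr_sumr; apply: ler_sum => k _.
rewrite /bump/= add1n (mulrC (al _)) mulrA; apply: ler_wpM2r => //.
exact: Ck.
Qed.

Section Concentration.
Context (R : realType) (dd : measure_display) (Om : measurableType dd).
Variable P : probability Om R.
Local Notation "''Ex' X" := (fine ('E_P[X%R])%E) (at level 10, X at level 8).
Variables (T : eqType) (s : seq T) (us : uniq s) (I : finType) (Q : pred I).
Variables (V : I -> Om -> T) (al : nat -> R) (dl : I -> I -> nat) (G : R).
Hypothesis dV : forall i, Q i -> discrete_rv s (V i).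
Hypothesis mix : forall i j, Q i -> Q j -> forall A C : set T,
  (`|P (V i @^-1` A `&` V j @^-1` C) -
      P (V i @^-1` A) * P (V j @^-1` C)| <= (al (dl i j))%:E)%E.
Hypothesis hG : forall i, Q i -> \sum_(j | Q j) al (dl i j) <= G.

(** Chebyshev reduces the claim to the variance, a double sum of covariances. For each fixed [i] the
    covariances with all [j] sum to a constant times [G], so the double sum grows only linearly in
    the number of indices. *)
Lemma mixing_average_deviation (phi : T -> R) (B k e : R) :
  (forall a, a \in s -> `|phi a| <= B) -> 0 < e ->
  let Z := fun w => k^-1 * \sum_(i | Q i) phi (V i w) in
  (fine (P [set w | e <= `|Z w - 'Ex Z|]) <=
    e ^- 2 * (k ^- 2 * (#|Q|%:R * ((size s)%:R ^+ 2 * B ^+ 2 * G))) : Prop).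
Proof.
move=> hphi e0 Z.
have bF i : Q i -> bounded_rv (fun w => phi (V i w)).
  by move=> /dV/(discrete_rv_bounded us); exact.
have bS : bounded_rv (fun w => \sum_(i | Q i) phi (V i w)) by exact: bounded_rv_sum.
have bZ : bounded_rv Z by exact: bounded_rvZ.
apply: le_trans (bounded_chebyshev P bZ e0) _.
have ie0 : 0 <= e ^- 2 by rewrite invr_ge0 exprn_ge0// ltW.
apply: ler_wpM2l => //.
rewrite /Z (fine_expectationZ P k^-1 bS).
set S := fun w => \sum_(i | Q i) phi (V i w).
have -> : (fun w => (k^-1 * \sum_(i | Q i) phi (V i w) - k^-1 * 'Ex S) *
    (k^-1 * \sum_(i | Q i) phi (V i w) - k^-1 * 'Ex S)) =
    (fun w => k ^- 2 * ((S w - 'Ex S) * (S w - 'Ex S))).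
  by apply/funext => w; rewrite /S -exprVn -!mulrBr expr2 mulrACA.
have bSE : bounded_rv (fun w => S w - 'Ex S).
  by apply: bounded_rvB => //; exact: bounded_rv_cst.
rewrite (fine_expectationZ P _ (bounded_rvM bSE bSE)).
apply: ler_wpM2l; first by rewrite -exprVn sqr_ge0.
rewrite (fine_variance_sum P bF).
rewrite -sum1_card natr_sum mulr_suml; apply: ler_sum => i Qi; rewrite mul1r.
have hLB : 0 <= (size s)%:R ^+ 2 * B ^+ 2 by rewrite mulr_ge0 ?sqr_ge0.
apply: le_trans (ler_wpM2l hLB (hG Qi)); rewrite mulr_sumr.
apply: ler_sum => j Qj; apply: mixing_covariance_le => //; last exact: mix.
- exact: dV.
- exact: dV.
Qed.

End Concentration.

(** * Admissible index pairs and the finite range of the observations *)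

Section IndexSums.
Variables (N p T : nat).
Hypothesis hT : (p + 3 <= T)%N.

Lemma sum_in_range (R : realType) (F : 'I_N -> nat -> R) :
  \sum_(p <= t < (T - 2).+1) \sum_(i < N) F i t =
  \sum_(y : 'I_N * 'I_T | in_range p T y.2) F y.1 y.2.
Proof.
rewrite -(pair_big_dep xpredT (fun _ (j : 'I_T) => in_range p T j)
  (fun i (j : 'I_T) => F i j))/= [RHS]exchange_big/=.
rewrite (@big_nat_widen _ _ _ _ _ T); last by lia.
rewrite big_geq_mkord; apply: eq_bigl => t; rewrite /in_range; lia.
Qed.

(** The times from [p] to [T - 2] number [T - p - 1], one more than the factor [T - p - 2] of the
    normalization. As [T - p - 2] is at least 1, a factor 2 absorbs the difference. *)
Lemma card_in_range : (#|[pred y : 'I_N * 'I_T | in_range p T y.2]| <=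
  2 * (N * (T - p - 2)))%N.
Proof.
rewrite -sum1_card -(pair_big_dep xpredT (fun _ (j : 'I_T) => in_range p T j)
  (fun i (j : 'I_T) => 1%N))/= sum_nat_const card_ord.
rewrite [X in (_ * X)%N](_ : _ = \sum_(p <= t < (T - 2).+1) 1)%N; last first.
  rewrite (@big_nat_widen _ _ _ _ _ T); last by lia.
  by rewrite big_geq_mkord; apply: eq_bigl => t; rewrite /in_range; lia.
rewrite sum_nat_const_nat muln1; nia.
Qed.

End IndexSums.

Section BoundedCubes.
Variables (S : finType) (M : nat).

(** The finite set of datacubes from (A1), carved out of an infinite type by listing functions into
    a finite type; [undup] gives uniqueness without an injectivity argument. *)
Definition bounded_cubes : seq (datacube S) :=
  undup [seq [ffun x => (nat_of_ord (f x).1, nat_of_ord (f x).2)]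
        | f : {ffun S -> 'I_M.+1 * 'I_M.+1}].

Lemma mem_bounded_cubes (h : datacube S) :
  (h \in bounded_cubes) = [forall x, ((h x).1 <= M)%N && ((h x).2 <= M)%N].
Proof.
rewrite mem_undup; apply/mapP/forallP => [[f _ ->] x|hM].
  by rewrite ffunE/=; apply/andP; split; rewrite -ltnS.
exists [ffun x => (inord (h x).1, inord (h x).2)]; first by rewrite mem_enum.
apply/ffunP => x; rewrite !ffunE/=; case/andP: (hM x) => h1 h2.
by rewrite !inordK ?ltnS//; case: (h x).
Qed.

Definition bounded_obs : seq (datacube S * datacube S) :=
  [seq (a, c) | a <- bounded_cubes, c <- bounded_cubes].

Lemma bounded_obs_uniq : uniq bounded_obs.
Proof. by apply: allpairs_uniq; rewrite ?undup_uniq// => -[? ?] [? ?]. Qed.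

Lemma mem_bounded_obs o :
  (o \in bounded_obs) = (o.1 \in bounded_cubes) && (o.2 \in bounded_cubes).
Proof.
case: o => a c /=; apply/allpairsP/andP => [[[x y] [hx hy [-> ->]]]//|[ha hc]].
by exists (a, c).
Qed.

End BoundedCubes.

(** * Bias, variance and deviation of the estimator for fixed [N] and [T] *)

Section KernelEstimator.
Context (R : realType) (S : finType) (dd : measure_display).
Context (Om : measurableType dd) (P : probability Om R).
Local Notation "''Ex' X" := (fine ('E_P[X%R])%E) (at level 10, X at level 8).
Variables (N p T M : nat) (n nplus : 'I_N -> nat -> S -> Om -> nat).
Variables (D : datacube S -> datacube S -> R) (b : R) (s : S) (hq : datacube S).
Variable g : S -> datacube S -> R.
Hypothesis hT : (p + 3 <= T)%N.
Hypothesis n_meas : forall i t x k, measurable (n i t x @^-1` [set k]).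
Hypothesis nplus_meas : forall i t x k, measurable (nplus i t x @^-1` [set k]).
Hypothesis counts_le : forall i t x w, (t < T)%N ->
  (n i t x w <= M)%N /\ (nplus i t x w <= M)%N.
Hypothesis g01 : forall x h, 0 <= g x h <= 1.
Hypothesis D_ge0 : forall h h', 0 <= D h h'.
Hypothesis b01 : 0 < b < 1.

Lemma measurable_count_vector (u v : S -> Om -> nat) (h : datacube S) :
  (forall x k, measurable (u x @^-1` [set k])) ->
  (forall x k, measurable (v x @^-1` [set k])) ->
  measurable [set w | [ffun x => (u x w, v x w)] = h].
Proof.
move=> mu mv; rewrite (_ : mkset _ = \bigcap_(x in [set: S])
    (u x @^-1` [set (h x).1] `&` v x @^-1` [set (h x).2])); last first.
  apply/seteqP; split => [w <- x _|w uv]; first by rewrite ffunE.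
  by apply/ffunP => x; rewrite ffunE; case: (uv x I) => /= -> ->; case: (h x).
apply: fin_bigcap_measurable => [|x _]; first exact: finite_finset.
exact: measurableI.
Qed.

(** An observation at [t] reads counts at [t.-1] and [t.+1]; the range [t <= T - 2] keeps
    [t.+1 < T], so the bound [M] covers both. *)
Lemma obs_discrete i t : in_range p T t ->
  discrete_rv (bounded_obs S M) (obs n nplus i t).
Proof.
rewrite /in_range => ht; split=> [w|[a c]].
  rewrite mem_bounded_obs !mem_bounded_cubes; apply/andP; split.
    apply/forallP => x; rewrite !ffunE/=.
    by have [|-> ->] := counts_le i x w (t := t.-1); first lia.
  apply/forallP => x; rewrite !ffunE/=.
  by have [|-> ->] := counts_le i x w (t := t.+1); first lia.
rewrite (_ : _ @^-1` _ = [set w | dcube n nplus i t w = a] `&`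
   [set w | [ffun x => (n i t.+1 x w, nplus i t.+1 x w)] = c]).
  by apply: measurableI; exact: measurable_count_vector.
by apply/seteqP; split => w /=; rewrite /obs => -[-> ->].
Qed.

Lemma kern_le1 h : 0 <= kern D b h hq <= 1.
Proof.
case/andP: b01 => b0 b1; rewrite /kern powR_ge0/= -(_ : 1 `^ D h hq = 1); last by rewrite powR1.
by apply: (ge0_ler_powR (D_ge0 h hq)); rewrite ?nnegrE ?(ltW b0) ?(ltW b1).
Qed.

Definition size_term (o : datacube S * datacube S) : R :=
  kern D b o.1 hq * (o.2 s).1%:R.

(** The multiplier is [g] at the query [hq], not at the observed cube [o.1]; this mismatch is the
    only source of bias. *)
Definition residual_term (o : datacube S * datacube S) : R :=
  kern D b o.1 hq * ((o.2 s).2%:R - g s hq * (o.2 s).1%:R).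

Lemma bounded_obs_le o : o \in bounded_obs S M ->
  ((o.2 s).1 <= M)%N /\ ((o.2 s).2 <= M)%N.
Proof.
rewrite mem_bounded_obs !mem_bounded_cubes => /andP[_ /forallP/(_ s)/andP[]].
by [].
Qed.

Lemma size_term_le o : o \in bounded_obs S M -> `|size_term o| <= M%:R.
Proof.
case/bounded_obs_le => h _; have /andP[k0 k1] := kern_le1 o.1.
rewrite /size_term normrM !ger0_norm// -[leRHS]mul1r ler_pM//.
by rewrite ler_nat.
Qed.

Lemma residual_term_le o : o \in bounded_obs S M -> `|residual_term o| <= M%:R.
Proof.
case/bounded_obs_le => h1 h2; have /andP[k0 k1] := kern_le1 o.1.
rewrite /residual_term normrM (ger0_norm k0) -[leRHS]mul1r ler_pM//.
have /andP[g0 g1] := g01 s hq.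
have gn : g s hq * (o.2 s).1%:R <= M%:R.
  by rewrite -[leRHS]mul1r ler_pM// ler_nat.
have gn0 : 0 <= g s hq * (o.2 s).1%:R by rewrite mulr_ge0.
have n2 : (o.2 s).2%:R <= M%:R :> R by rewrite ler_nat.
by rewrite ler_norml; apply/andP; split; have := ler0n R (o.2 s).2; lra.
Qed.

Let K : R := (N * (T - p - 2))%:R.

Definition residual (w : Om) : R :=
  hhat n nplus p T D b s hq w - g s hq * fhat n nplus p T D b s hq w.

Lemma fhatE : fhat n nplus p T D b s hq = (fun w => K^-1 *
  \sum_(y : 'I_N * 'I_T | in_range p T y.2) size_term (obs n nplus y.1 y.2 w)).
Proof.
apply/funext => w; rewrite /fhat sum_in_range//; congr (_ * _).
by apply: eq_bigr => y _; rewrite /size_term /obs/= ffunE.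
Qed.

Lemma residualE : residual = (fun w => K^-1 *
  \sum_(y : 'I_N * 'I_T | in_range p T y.2) residual_term (obs n nplus y.1 y.2 w)).
Proof.
apply/funext => w; rewrite /residual /hhat /fhat !sum_in_range//.
rewrite mulrCA -mulrBr mulr_sumr -sumrB; congr (_ * _).
apply: eq_bigr => y _; rewrite /residual_term /obs/= !ffunE/=; ring.
Qed.

Lemma obs_term_bounded (phi : datacube S * datacube S -> R) (y : 'I_N * 'I_T) :
  in_range p T y.2 -> bounded_rv (fun w => phi (obs n nplus y.1 y.2 w)).
Proof.
move=> hy; exact: (discrete_rv_bounded (bounded_obs_uniq S M) _ (obs_discrete y.1 hy)).
Qed.

Lemma obs_average_bounded (phi : datacube S * datacube S -> R) :
  bounded_rv (fun w => K^-1 *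
    \sum_(y : 'I_N * 'I_T | in_range p T y.2) phi (obs n nplus y.1 y.2 w)).
Proof.
by apply/bounded_rvZ/bounded_rv_sum => y; exact: obs_term_bounded.
Qed.

Hypothesis modelM : forall (i : 'I_N) t x (h : datacube S) (m : nat),
  in_range p T t ->
  ('E_P[(fun w => (nplus i t.+1 x w)%:R *
     (((dcube n nplus i t w == h) && (n i t.+1 x w == m))%:R : R))%R]
   = (m%:R * g x h)%:E *
     P [set w | dcube n nplus i t w = h /\ n i t.+1 x w = m])%E.

(** Split according to the values [(h, m)] of the datacube and the count. By (M), each piece has
    mean [kern * (g s h - g s hq) * m * P(h, m)]: it vanishes for [h = hq], and otherwise the kernel
    is at most [eta]. *)
Lemma residual_term_bias (i : 'I_N) t eta : in_range p T t ->
  (forall h, h \in bounded_cubes S M -> h != hq -> b `^ D h hq <= eta) ->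
  0 <= eta ->
  `|'Ex (fun w => residual_term (obs n nplus i t w))| <=
  (size (bounded_cubes S M) * M.+1)%:R * (eta * M%:R).
Proof.
move=> ht heta eta0.
pose ind h m (w : Om) : R := ((dcube n nplus i t w == h) && (n i t.+1 s w == m))%:R.
have mA h m : measurable [set w | dcube n nplus i t w = h /\ n i t.+1 s w = m].
  by apply: measurableI (n_meas i t.+1 s m); exact: measurable_count_vector.
have indE h m :
    ind h m = \1_[set w | dcube n nplus i t w = h /\ n i t.+1 s w = m].
  apply/funext => w; rewrite indicE /ind; congr ((nat_of_bool _)%:R).
  by apply/andP/idP => [[/eqP ? /eqP ?]|]; rewrite inE//= => -[-> ->].
have bI h m : bounded_rv (ind h m) by rewrite indE; exact: bounded_rv_indic.
have bN : bounded_rv (fun w => (nplus i t.+1 s w)%:R : R).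
  have := discrete_rv_bounded (bounded_obs_uniq S M)
    (fun o => (o.2 s).2%:R : R) (obs_discrete i ht).
  by congr bounded_rv; apply/funext => w; rewrite /= ffunE.
have bNI h m := bounded_rvM bN (bI h m).
have bT h m : bounded_rv (fun w => (nplus i t.+1 s w)%:R * ind h m w
    - g s hq * m%:R * ind h m w).
  by apply: bounded_rvB => //; exact: bounded_rvZ.
(* At each [w] exactly one pair [(h, m)] has a nonzero indicator, and (A1) places it within the two
   finite ranges. *)
have -> : (fun w => residual_term (obs n nplus i t w)) =
    (fun w => \sum_(h <- bounded_cubes S M) \sum_(m < M.+1)
       kern D b h hq * ((nplus i t.+1 s w)%:R * ind h m w
                        - g s hq * m%:R * ind h m w)).
  apply/funext => w; have [/(_ w)] := obs_discrete i ht.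
  rewrite mem_bounded_obs => /andP[hc _] _.
  rewrite (bigD1_seq (dcube n nplus i t w)) ?undup_uniq//=.
  rewrite [X in _ = _ + X]big1 ?addr0 => [|h hne]; last first.
    apply: big1 => m _; rewrite /ind eq_sym (negbTE hne)/=; ring.
  have nM : (n i t.+1 s w < M.+1)%N.
    have /andP[_ ht2] := ht.
    by have [|] := counts_le i s w (t := t.+1); first lia.
  rewrite (bigD1 (Ordinal nM))//= big1 ?addr0 => [|m hne]; last first.
    rewrite /ind eqxx/= eq_sym (_ : (nat_of_ord m == _) = false) ?mulr0 ?subr0 ?mulr0//.
    by apply/negbTE.
  by rewrite /ind !eqxx/= !mulr1 /residual_term /obs/= ffunE.
rewrite fine_expectation_sum => [|h _]; last first.
  by apply: bounded_rv_sum => m _; exact: bounded_rvZ.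
have -> : (size (bounded_cubes S M) * M.+1)%:R * (eta * M%:R) =
    \sum_(h <- bounded_cubes S M) \sum_(m < M.+1) eta * M%:R.
  rewrite big_const_seq count_predT iter_addr_0 sumr_const card_ord.
  by rewrite -mulrnA mulnC -[RHS]mulr_natl.
rewrite (le_trans (ler_norm_sum _ _ _))// big_seq [leRHS]big_seq.
apply: ler_sum => h hc; rewrite fine_expectation_sum => [|m _]; last exact: bounded_rvZ.
rewrite (le_trans (ler_norm_sum _ _ _))//; apply: ler_sum => m _.
rewrite (fine_expectationZ P _ (bT h m)).
rewrite (fine_expectationB P (bNI h m) (bounded_rvZ _ (bI h m))).
rewrite (fine_expectationZ P _ (bI h m)) modelM// indE fine_expectation_indic//.
set A := mkset _; have mA' : measurable A := mA h m.
rewrite fineM ?fin_num_measure//=.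
have -> : kern D b h hq * (m%:R * g s h * fine (P A) - g s hq * m%:R * fine (P A))
   = kern D b h hq * (g s h - g s hq) * (m%:R * fine (P A)) by ring.
have P0 : 0 <= fine (P A) by rewrite fine_ge0.
have P1 : fine (P A) <= 1.
  by rewrite -lee_fin fineK ?fin_num_measure//; exact: probability_le1.
rewrite normrM ler_pM// ?normr_ge0//; last first.
  rewrite ger0_norm ?mulr_ge0// -[leRHS]mulr1 ler_pM// ler_nat -ltnS//.
have [->|hne] := eqVneq h hq; first by rewrite subrr mulr0 normr0.
rewrite normrM -[leRHS]mulr1 ler_pM//.
  by rewrite ger0_norm ?powR_ge0//; exact: heta.
have /andP[? ?] := g01 s h; have /andP[? ?] := g01 s hq.
by rewrite ler_norml; apply/andP; split; lra.
Qed.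

Hypothesis K_gt0 : 0 < K.

(** The factor 2 is the ratio of the number of index pairs to the normalization [K], bounded in
    [card_in_range]. *)
Lemma residual_bias eta :
  (forall h, h \in bounded_cubes S M -> h != hq -> b `^ D h hq <= eta) ->
  0 <= eta ->
  `|'Ex residual| <=
  2 * ((size (bounded_cubes S M) * M.+1)%:R * (eta * M%:R)).
Proof.
move=> heta eta0; set B := (_ * M.+1)%:R * _.
have bS : bounded_rv (fun w => \sum_(y : 'I_N * 'I_T | in_range p T y.2)
    residual_term (obs n nplus y.1 y.2 w)).
  by apply: bounded_rv_sum => y; exact: obs_term_bounded.
rewrite residualE (fine_expectationZ P _ bS) fine_expectation_sum => [|y]; last first.
  exact: obs_term_bounded.
have B0 : 0 <= B by rewrite /B !mulr_ge0.
rewrite normrM normfV (gtr0_norm K_gt0) mulrC ler_pdivrMr//.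
rewrite (le_trans (ler_norm_sum _ _ _))//.
apply: (@le_trans _ _ (\sum_(y : 'I_N * 'I_T | in_range p T y.2) B)).
  by apply: ler_sum => y hy; exact: residual_term_bias.
rewrite (_ : \sum_(_ | _) _ = #|[pred y : 'I_N * 'I_T | in_range p T y.2]|%:R * B);
  last by rewrite mulr_natl -sumr_const.
rewrite mulrAC ler_wpM2r// -natrM ler_nat; exact: card_in_range.
Qed.

Variables (al : nat -> R) (dl : 'I_N * 'I_T -> 'I_N * 'I_T -> nat) (G : R).
Hypothesis mixing : forall x y : 'I_N * 'I_T,
  in_range p T x.2 -> in_range p T y.2 ->
  forall A B : set (datacube S * datacube S),
  (`| P (obs n nplus x.1 x.2 @^-1` A `&` obs n nplus y.1 y.2 @^-1` B)
     - P (obs n nplus x.1 x.2 @^-1` A) * P (obs n nplus y.1 y.2 @^-1` B) |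
   <= (al (dl x y))%:E)%E.
Hypothesis growth : forall x : 'I_N * 'I_T, in_range p T x.2 ->
  \sum_(y : 'I_N * 'I_T | in_range p T y.2) al (dl x y) <= G.
Hypothesis G_ge0 : 0 <= G.

(** Bounds the sum of the covariances of one summand with all the others; with at most [2 * K]
    summands and the factor [K ^- 2], averages have variance at most [2 * V / K]. *)
Let V : R := (size (bounded_obs S M))%:R ^+ 2 * M%:R ^+ 2 * G.

Lemma obs_average_deviation (phi : datacube S * datacube S -> R) e :
  (forall o, o \in bounded_obs S M -> `|phi o| <= M%:R) -> 0 < e ->
  let Z := fun w => K^-1 *
    \sum_(y : 'I_N * 'I_T | in_range p T y.2) phi (obs n nplus y.1 y.2 w) in
  (fine (P [set w | e <= `|Z w - 'Ex Z|]) <= e ^- 2 * (2 * V / K) : Prop).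
Proof.
move=> hphi e0 Z.
have := @mixing_average_deviation R dd Om P _ _ (bounded_obs_uniq S M) _
  [pred y : 'I_N * 'I_T | in_range p T y.2]
  (fun y => obs n nplus y.1 y.2) al dl G _ mixing growth phi M%:R K e hphi e0.
move=> /(_ (fun y hy => obs_discrete y.1 hy))/le_trans; apply.
apply: ler_wpM2l; first by rewrite invr_ge0 exprn_ge0// ltW.
rewrite -/V mulrC ler_pdivrMr ?exprn_gt0//.
have -> : 2 * V / K * K ^+ 2 = (2 * K) * V.
  by rewrite expr2 mulrA divfK ?gt_eqF// mulrAC.
have V0 : 0 <= V by rewrite /V !mulr_ge0 ?exprn_ge0.
rewrite ler_wpM2r// -natrM ler_nat; exact: card_in_range.
Qed.

(** A failure of the estimator forces [fhat] or the residual away from its mean, by [c / 2] or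
    [eps * c / 4] respectively; a union bound over these two events concludes. *)
Lemma ghat_deviation eps c eta :
  0 < eps -> 0 < c -> 0 <= eta ->
  (c%:E <= 'E_P[fhat n nplus p T D b s hq])%E ->
  (forall h, h \in bounded_cubes S M -> h != hq -> b `^ D h hq <= eta) ->
  2 * ((size (bounded_cubes S M) * M.+1)%:R * (eta * M%:R)) <= eps * c / 4 ->
  (P [set w | (~ (0 < fhat n nplus p T D b s hq w) \/
       eps < `| ghat n nplus p T D b s hq w - g s hq |)%R] <=
   (((c / 2) ^- 2 + (eps * c / 4) ^- 2) * (2 * V / K))%:E)%E.
Proof.
move=> eps0 c0 eta0 hc heta hbias.
set F := fhat _ _ _ _ _ _ _ _ in hc *.
have bF : bounded_rv F by rewrite /F fhatE; exact: obs_average_bounded.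
rewrite -(fineK (expectation_fin_num (bounded_rv_Lfun P bF))) lee_fin in hc.
have bW : bounded_rv residual by rewrite residualE; exact: obs_average_bounded.
pose A1 := [set w | c / 2 <= `|F w - 'Ex F|].
pose A2 := [set w | eps * c / 4 <= `|residual w - 'Ex residual|].
have mA1 : measurable A1 by exact: measurable_abs_sub_ge.
have mA2 : measurable A2 by exact: measurable_abs_sub_ge.
have e10 : 0 < c / 2 by rewrite divr_gt0.
have e20 : 0 < eps * c / 4 by rewrite divr_gt0 ?mulr_gt0.
have PA1 := obs_average_deviation size_term_le e10; rewrite -fhatE -/F -/A1 in PA1.
have PA2 := obs_average_deviation residual_term_le e20.
rewrite -residualE -/A2 in PA2.
have ghatE w : 0 < F w -> ghat n nplus p T D b s hq w - g s hq = residual w / F w.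
  by move=> F0; rewrite /ghat /residual mulrBl mulfK// gt_eqF.
(* Multiplying out the division leaves a condition on [F] and the residual that is visibly
   measurable; where [F w <= 0] both sides hold, whatever value the quotient takes. *)
have badE w : (~ (0 < F w) \/ eps < `|ghat n nplus p T D b s hq w - g s hq|) <->
    F w <= 0 \/ eps * F w < `|residual w|.
  have [F0|F0] := ltP 0 (F w).
    rewrite ghatE// normrM normfV (gtr0_norm F0) ltr_pdivlMr//.
    by split=> [[//|]|[//|]]; right.
  by split=> _; left.
set bad := mkset _.
have -> : bad = (F @^-1` `]-oo, 0]) `|` [set w | eps * F w < `|residual w|].
  by apply/seteqP; split => w /badE []; rewrite ?in_itv/=; [left|right|left|right];
    rewrite //= ?in_itv.
have mb2 : measurable [set w | eps * F w < `|residual w|].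
  have m1 : measurable_fun setT (fun w => eps * F w) by case: (bounded_rvZ eps bF).
  have m2 : measurable_fun setT (fun w => `|residual w|).
    by apply: measurableT_comp => //; case: bW.
  have := measurable_fun_ltr m1 m2 measurableT (Y := [set true]).
  by rewrite setTI; apply.
have mb1 : measurable (F @^-1` `]-oo, 0]).
  by rewrite -[X in measurable X]setTI; apply: bF.1.
(* Outside [A1], [F] exceeds [c / 2] because its mean is at least [c]. The residual then exceeds
   [eps * c / 2], and its mean accounts for at most half of that. *)
have sub : (F @^-1` `]-oo, 0]) `|` [set w | eps * F w < `|residual w|] `<=` A1 `|` A2.
  move=> w hw; have [hF|hF] := leP (c / 2) `|F w - 'Ex F|; [by left|right].
  have Fc : c / 2 < F w by move: hF; rewrite ltr_norml => /andP[? ?]; lra.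
  case: hw => /=; first by rewrite in_itv/=; lra.
  move=> hw; rewrite /A2/=.
  have hb := le_trans (residual_bias heta eta0) hbias.
  have h1 : eps * (c / 2) < `|residual w|.
    by apply: le_lt_trans hw; rewrite ler_pM2l// ltW.
  have := lerB_dist (residual w) ('Ex residual); lra.
apply: (@le_trans _ _ (P (A1 `|` A2))).
  by apply: le_measure => //; rewrite inE; exact: measurableU.
apply: (le_trans (measureU2 P mA1 mA2)).
by rewrite mulrDl EFinD leeD// -[leLHS]fineK ?fin_num_measure// lee_fin.
Qed.

End KernelEstimator.

(** * Eventual statements and the passage to the limit *)

Lemma eventuallyNT_and p (Q1 Q2 : nat -> nat -> Prop) :
  eventuallyNT p Q1 -> eventuallyNT p Q2 ->
  eventuallyNT p (fun N T => Q1 N T /\ Q2 N T).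
Proof.
move=> [K1 h1] [K2 h2]; exists (maxn K1 K2) => N T hT.
by rewrite geq_max => /andP[? ?]; split; [exact: h1|exact: h2].
Qed.

(** Finitely many thresholds have a maximum; this makes the kernel decay uniform over the finite set
    of datacubes. *)
Lemma eventuallyNT_all p (I : eqType) (r : seq I) (Q : I -> nat -> nat -> Prop) :
  (forall i, i \in r -> eventuallyNT p (Q i)) ->
  eventuallyNT p (fun N T => forall i, i \in r -> Q i N T).
Proof.
elim: r => [_|i r IH hQ]; first by exists 0%N.
have [|K1 h1] := IH; first by move=> j jr; apply: hQ; rewrite inE jr orbT.
have [K2 h2] := hQ i (mem_head _ _).
exists (maxn K1 K2) => N T hT; rewrite geq_max => /andP[hK1 hK2] j.
rewrite inE => /predU1P[->|]; first exact: h2.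
exact: h1.
Qed.

Lemma eventually_powR_le (R : realType) p (b : nat -> nat -> R) (a eta : R) :
  (forall N T, 0 < b N T) ->
  (forall e : R, 0 < e -> eventuallyNT p (fun N T => b N T <= e)) ->
  0 < a -> 0 < eta -> eventuallyNT p (fun N T => b N T `^ a <= eta).
Proof.
move=> b0 hb a0 eta0; have [|K hK] := hb (eta `^ a^-1); first exact: powR_gt0.
exists K => N T hT /(hK _ _ hT) h.
rewrite -[leRHS](powRr1 (ltW eta0)) -(mulVf (lt0r_neq0 a0)) powRrM.
by apply: ge0_ler_powR => //; rewrite ?nnegrE ?powR_ge0// ltW.
Qed.

(* Since T - p - 2 >= 1, the normalization N (T - p - 2) is at least
   N T / (p + 3). *)
Lemma eventually_normalization_le (R : realType) p (c delta : R) : 0 < delta ->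
  eventuallyNT p (fun N T => (0 < (N * (T - p - 2))%:R :> R) /\
    c / (N * (T - p - 2))%:R <= delta).
Proof.
move=> d0; pose m := Num.truncn `|c / delta|.
exists ((p + 3) * m.+1)%N => N T hT hK.
have hm : (m.+1 <= N * (T - p - 2))%N.
  rewrite -(@leq_pmul2l (p + 3)); last by rewrite addn3.
  apply: leq_trans hK _.
  by rewrite mulnCA leq_mul2l; apply/orP; right; nia.
have K0 : 0 < (N * (T - p - 2))%:R :> R by rewrite ltr0n (leq_trans _ hm).
split=> //; rewrite ler_pdivrMr// mulrC -ler_pdivrMr//.
apply: le_trans (ler_norm _) _; apply: ltW.
by apply: lt_le_trans (truncnS_gt _) _; rewrite ler_nat.
Qed.

Theorem theorem1 (R : realType) (S : finType) (p : nat) (hp : (1 <= p)%N)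
  (d : nat -> nat -> measure_display)
  (Om : forall N T : nat, measurableType (d N T))
  (P : forall N T : nat, probability (Om N T) R)
  (n nplus : forall N T : nat, 'I_N -> nat -> S -> Om N T -> nat)
  (g : S -> datacube S -> R)
  (D : datacube S -> datacube S -> R)
  (b : nat -> nat -> R)
  (M : nat)
  (dist : forall N T : nat, 'I_N * nat -> 'I_N * nat -> nat)
  (alpha : nat -> R) (rho C : R)
  (s : S) (hq : datacube S)
  (* measurability of the (finite-valued) count random variables *)
  (hmeas_n : forall N T i t s' k, measurable (n N T i t s' @^-1` [set k]))
  (hmeas_np : forall N T i t s' k, measurable (nplus N T i t s' @^-1` [set k]))
  (* g takes values in [0,1] *)
  (hg : forall s' h, 0 <= g s' h <= 1)
  (* the distance D: D >= 0 and D(h,h') = 0 iff h = h' *)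
  (hD0 : forall h h', 0 <= D h h')
  (hDeq : forall h h', D h h' = 0 <-> h = h')
  (* bandwidth 0 < b < 1, and (A2) b -> 0 as NT -> oo *)
  (hb : forall N T, 0 < b N T < 1)
  (hA2 : forall e : R, 0 < e -> eventuallyNT p (fun N T => b N T <= e))
  (* (A1) all counts bounded by a constant M independent of N, T *)
  (hA1 : forall N T i t s' w, (t < T)%N ->
      (n N T i t s' w <= M)%N /\ (nplus N T i t s' w <= M)%N)
  (* (M): E[n^+_{i,t+1}(s) | h_{i,t}, n_{i,t+1}(s)] = n_{i,t+1}(s) g(s, h_{i,t}) *)
  (hM : forall N T (i : 'I_N) t s' (h : datacube S) (m : nat), in_range p T t ->
      ('E_(P N T)[(fun w => (nplus N T i t.+1 s' w)%:R *
          (((dcube (n N T) (nplus N T) i t w == h) &&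
            (n N T i t.+1 s' w == m))%:R : R))%R]
       = (m%:R * g s' h)%:E *
         P N T [set w | dcube (n N T) (nplus N T) i t w = h /\ n N T i t.+1 s' w = m])%E)
  (* (A3) strong mixing *)
  (halpha0 : forall k, 0 <= alpha k)
  (hA3 : forall N T (x y : 'I_N * nat) (k : nat),
      in_range p T x.2 -> in_range p T y.2 -> (k <= dist N T x y)%N ->
      forall A B : set (datacube S * datacube S),
      (`| P N T (obs (n N T) (nplus N T) x.1 x.2 @^-1` A `&`
                 obs (n N T) (nplus N T) y.1 y.2 @^-1` B)
         - P N T (obs (n N T) (nplus N T) x.1 x.2 @^-1` A) *
           P N T (obs (n N T) (nplus N T) y.1 y.2 @^-1` B) | <= (alpha k)%:E)%E)
  (hA3sum : cvgn (series (fun k => alpha k.+1 * (k.+1)%:R `^ (rho - 1)) : R^nat))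
  (* (A4) growth *)
  (hA4_0 : forall N T (x : 'I_N * nat), in_range p T x.2 ->
      #|[pred y : 'I_N * 'I_T | in_range p T y.2 &&
           (dist N T x (y.1, nat_of_ord y.2) == 0%N)]|%:R <= C)
  (hA4_d : forall N T (x : 'I_N * nat) (dd : nat), in_range p T x.2 -> (1 <= dd)%N ->
      #|[pred y : 'I_N * 'I_T | in_range p T y.2 &&
           (dist N T x (y.1, nat_of_ord y.2) == dd)]|%:R <= C * dd%:R `^ (rho - 1))
  (* liminf_{NT -> oo} E[fhat(s,hq)] > 0 *)
  (hliminf : exists c : R, 0 < c /\ eventuallyNT p (fun N T =>
      (c%:E <= 'E_(P N T)[fhat (n N T) (nplus N T) p T D (b N T) s hq])%E)) :
  (* ghat(s,hq) -> g(s,hq) in probability (ghat undefined counts as failure) *)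
  forall eps delta : R, 0 < eps -> 0 < delta ->
  eventuallyNT p (fun N T =>
    (P N T [set w | (~ (0 < fhat (n N T) (nplus N T) p T D (b N T) s hq w) \/
                    eps < `| ghat (n N T) (nplus N T) p T D (b N T) s hq w - g s hq |)%R]
     <= delta%:E)%E).
Proof.
move=> eps delta eps0 delta0; case: hliminf => c [c0 hc].
pose G := C * (alpha 0%N +
  limn (series (fun k => alpha k.+1 * k.+1%:R `^ (rho - 1)) : R^nat)).
pose V : R := (size (bounded_obs S M))%:R ^+ 2 * M%:R ^+ 2 * G.
pose L : R := (size (bounded_cubes S M) * M.+1)%:R.
(* Chosen so that the bias bound is [eps * c / 4] times a ratio below 1; the added 1 keeps the
   denominator positive when [L * M] is 0. *)
pose eta := eps * c / 4 / (2 * (L * M%:R + 1)).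
have LM0 : 0 <= L * M%:R by rewrite mulr_ge0.
have eta0 : 0 < eta by rewrite !divr_gt0 ?mulr_gt0// ltr_wpDl.
have hbias : 2 * (L * (eta * M%:R)) <= eps * c / 4.
  have -> : 2 * (L * (eta * M%:R)) = eps * c / 4 * ((L * M%:R) / (L * M%:R + 1)).
    by rewrite /eta; field; rewrite gt_eqF// ltr_wpDl.
  rewrite ger_pMr ?divr_gt0 ?mulr_gt0// ler_pdivrMr ?ltr_wpDl// mul1r lerDl//.
have heta : eventuallyNT p (fun N T => forall h, h \in bounded_cubes S M ->
    h != hq -> b N T `^ D h hq <= eta).
  apply: eventuallyNT_all => h _; have [->|hne] := eqVneq h hq; first by exists 0%N.
  have [||K hK] := @eventually_powR_le R p b (D h hq) eta _ hA2 _ eta0.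
  - by move=> N T; case/andP: (hb N T).
  - by rewrite lt_neqAle hD0 andbT eq_sym; apply: contra_neq hne => /hDeq.
  - by exists K => N T hT hNT _; exact: hK.
have hK := eventually_normalization_le p
  (((c / 2) ^- 2 + (eps * c / 4) ^- 2) * (2 * V)) delta0.
have [K0 {}hK] := eventuallyNT_and hc (eventuallyNT_and heta hK).
exists K0 => N T hT hNT; have [{}hc [{}heta [K_gt0 hV]]] := hK N T hT hNT.
pose dl (x y : 'I_N * 'I_T) :=
  dist N T (x.1, nat_of_ord x.2) (y.1, nat_of_ord y.2).
have growth (x : 'I_N * 'I_T) : in_range p T x.2 ->
    \sum_(y : 'I_N * 'I_T | in_range p T y.2) alpha (dl x y) <= G.
  move=> hx; apply: sum_mixing_le => //.
    exact: (hA4_0 N T (x.1, nat_of_ord x.2)).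
  by move=> k hk; exact: (hA4_d N T (x.1, nat_of_ord x.2)).
have N0 : (0 < N)%N by move: K_gt0; rewrite ltr0n muln_gt0 => /andP[].
have pT : (p < T)%N by lia.
(* [G] dominates a sum of nonnegative coefficients as soon as one admissible index pair exists; node
   0 at time [p] is one. *)
have G_ge0 : 0 <= G.
  apply: le_trans (growth (Ordinal N0, Ordinal pT) _); first exact: sumr_ge0.
  by rewrite /in_range/=; lia.
apply: (le_trans (@ghat_deviation R S _ _ (P N T) N p T M (n N T) (nplus N T)
  D (b N T) s hq g hT (hmeas_n N T) (hmeas_np N T) (hA1 N T) hg hD0 (hb N T)
  (hM N T) K_gt0 alpha dl G _ growth G_ge0 eps c eta eps0 c0 (ltW eta0) hc heta
  hbias)).
  move=> x y hx hy A B.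
  exact: (hA3 N T (x.1, nat_of_ord x.2) (y.1, nat_of_ord y.2)).
by rewrite lee_fin (le_trans _ hV)// -[leRHS]mulrA.
Qed.
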